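(* Let $p$ be a prime number and let $A$ be a perfectoid ring (with respect to $p$). If $A$ is a Banach field (that is, the underlying ring of $A$ is a field), then $A$ is a perfectoid field.
   Context: All rings are commutative with unit. A submultiplicative (nonarchimedean) norm on a ring $R$ is a function $|\cdot|: R \to [0,\infty)$ with $|x| = 0$ if and only if $x=0$, $|x-y| \leq \max\{|x|,|y|\}$ and $|xy| \leq |x||y|$ for all $x,y \in R$; it is a multiplicative norm if moreover $|xy| = |x||y|$ always and $|1| \neq 0$. A Banach ring is a complete topological commutative ring whose topology is induced by some submultiplicative norm; it is nondiscrete if its topology is not the discrete one. A Banach field is a Banach ring whose underlying ring is a field. A nonarchimedean field is a nondiscrete Banach field whose topology is induced by some multiplicative nonarchimedean norm. For a Banach ring $A$, a subset $S \subseteq A$ is bounded if for every neighborhood $U$ of $0$ there is a neighborhood $V$ of $0$ with $vs \in U$ for all $v \in V$, $s \in S$. An element $x \in A$ is power-bounded if $\{x^n : n \geq 0\}$ is bounded, and topologically nilpotent if $x^n \to 0$; $A^\circ$ denotes the subring of power-bounded elements. $A$ is uniform if $A^\circ$ is bounded in $A$. Fix a prime $p$. A perfectoid ring (in the sense of Fontaine) is a uniform Banach ring $A$ containing a topologically nilpotent unit $\varpi$ such that $\varpi^p$ divides $p$ in $A^\circ$ and the Frobenius map $\varphi: A^\circ/(\varpi) \to A^\circ/(\varpi^p)$, $x \mapsto x^p$, is surjective. A perfectoid field is a perfectoid ring which is a nonarchimedean field. *)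

(* Defs.v *)
From HB Require Import structures.
From mathcomp Require Import all_boot all_order all_algebra.
From mathcomp Require Import all_classical all_reals all_analysis.

Set Implicit Arguments.
Unset Strict Implicit.
Unset Printing Implicit Defensive.

Import Order.TTheory GRing.Theory Num.Theory.

Local Open Scope classical_set_scope.
Local Open Scope ring_scope.

HB.mixin Record TopologicalZmodule_isTopologicalRing A
    & TopologicalZmodule A & GRing.ComPzRing A := {
  ring_mul_continuous : continuous (fun x : A * A => x.1 * x.2)
}.

#[short(type="topologicalComRingType")]
HB.structure Definition TopologicalComRing :=
  {A of TopologicalZmodule A & GRing.ComPzRing A
      & TopologicalZmodule_isTopologicalRing A}.

Record submultiplicative_norm (R : realType) (A : comPzRingType)
    (nu : A -> R) : Prop := {
  norm_nonneg : forall x, 0 <= nu x;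
  norm_eq0 : forall x, nu x = 0 <-> x = 0;
  norm_ultra : forall x y, nu (x - y) <= Num.max (nu x) (nu y);
  norm_submul : forall x y, nu (x * y) <= nu x * nu y
}.

Record multiplicative_norm (R : realType) (A : comPzRingType)
    (nu : A -> R) : Prop := {
  multiplicative_norm_submul : submultiplicative_norm nu;
  norm_mul : forall x y, nu (x * y) = nu x * nu y;
  norm_one_neq0 : nu 1 <> 0
}.

Definition induces_topology (R : realType) (A : topologicalComRingType)
    (nu : A -> R) : Prop :=
  forall x : A, nbhs x = nbhs_ball_ (ball_ nu) x.

(* The Cauchy condition refers to the uniform structure of the additive
   topological group of A. *)
Definition cauchy_filter (A : topologicalComRingType) (F : set_system A) :=
  forall U : set A, nbhs 0 U ->
    exists2 S : set A, F S & forall x y, S x -> S y -> U (x - y).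

Definition complete_ring (A : topologicalComRingType) : Prop :=
  forall F : set_system A, ProperFilter F -> cauchy_filter F ->
    exists l : A, F --> l.

Definition discrete_ring (A : topologicalComRingType) : Prop :=
  forall U : set A, open U.

Definition banach_ring (R : realType) (A : topologicalComRingType) : Prop :=
  complete_ring A /\
  exists nu : A -> R, submultiplicative_norm nu /\ induces_topology nu.

Definition ring_unit (A : comPzRingType) (x : A) : Prop :=
  exists y : A, x * y = 1.

Definition ring_is_field (A : comPzRingType) : Prop :=
  (1 : A) <> 0 /\ forall x : A, x <> 0 -> ring_unit x.

Definition banach_field (R : realType) (A : topologicalComRingType) : Prop :=
  banach_ring R A /\ ring_is_field A.

Definition nonarchimedean_field (R : realType) (A : topologicalComRingType) :
    Prop :=
  [/\ banach_field R A, ~ discrete_ring A &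
      exists nu : A -> R, multiplicative_norm nu /\ induces_topology nu].

Definition bounded_subset (A : topologicalComRingType) (S : set A) : Prop :=
  forall U : set A, nbhs 0 U ->
    exists2 V : set A, nbhs 0 V & forall v s, V v -> S s -> U (v * s).

Definition power_bounded (A : topologicalComRingType) : set A :=
  [set x | bounded_subset (range (fun n : nat => x ^+ n))].
Arguments power_bounded : clear implicits.

Definition topologically_nilpotent (A : topologicalComRingType) (x : A) :
    Prop :=
  (fun n : nat => x ^+ n) @ \oo --> (0 : A).

Definition uniform_ring (A : topologicalComRingType) : Prop :=
  bounded_subset (power_bounded A).

(* Below, B is meant to be a subring of A and a an element of B. *)
Definition coset (A : comPzRingType) (B : set A) (a x : A) : set A :=
  [set x + a * b | b in B].

Definition quotient_ring (A : comPzRingType) (B : set A) (a : A) :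
    set (set A) :=
  [set coset B a x | x in B].

(* B/(a) -> B/(a^p), x |-> x^p.  The union runs over the representatives x of
   the class C; if a^p divides p in B, then all of them give the same class. *)
Definition frobenius (A : comPzRingType) (B : set A) (p : nat) (a : A)
    (C : set A) : set A :=
  \bigcup_(x in C) coset B (a ^+ p) (x ^+ p).

Definition perfectoid_ring (R : realType) (p : nat)
    (A : topologicalComRingType) : Prop :=
  [/\ banach_ring R A, uniform_ring A &
    exists w : A,
      [/\ ring_unit w, topologically_nilpotent w,
          exists2 c : A, power_bounded A c & p%:R = w ^+ p * c &
          set_surj (quotient_ring (power_bounded A) w)
            (quotient_ring (power_bounded A) (w ^+ p))
            (frobenius (power_bounded A) p w)]].

Definition perfectoid_field (R : realType) (p : nat)
    (A : topologicalComRingType) : Prop :=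
  perfectoid_ring R p A /\ nonarchimedean_field R A.

(* Main.v *)
Require Import Defs.
From mathcomp Require Import all_boot all_order all_algebra.
From mathcomp Require Import all_classical all_reals all_analysis.
From mathcomp Require Import zify ring lra.

(** The reason is that every uniform Banach field A with a topologically
nilpotent unit w is a nonarchimedean field.

For an integer a put V a = w^a A°, where A° is the ring of power-bounded
elements.  Since A° is a bounded ring, the V a form a basis of neighborhoods
of 0 and a multiplicative filtration, and A° contains every element whose
powers all lie in one V b ([closed_filtration]).  Write v(x) for the largest
a with x in V a.  Then v(xy) >= v(x) + v(y), and the point is to bound the
defect of multiplicativity, which amounts to v(x) + v(1/x) >= -2 for all
x <> 0 ([quasi_inverse]).

Suppose that this fails for some x.  Scaled powers of x give f with
v(f) <= 0 and v(1/f) as negative as desired, say v(1/f) < -4t.  Let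
c = w^(3t) and h = 1/(f + c).  If v(h) < -4t - 4, let f' = f + c.  If not,
let f' = f^2 h; then f' - f = c^2 h - c is small, and
1/f' = 1/f + c/f^2 is large because the second summand dominates.  In both
cases v(f' - f) >= t and v(1/f') < -4(t + 1) ([perturbation_step]).
Iterating, one gets a Cauchy sequence f_n whose inverses are unbounded.  Its
limit is nonzero since v(f_n) <= 0, hence is invertible as A is a field; but
inversion is continuous at a unit, so the inverses are bounded
([inverses_bounded]), a contradiction.

Hence v is additive up to a bounded error, and its homogenization
L(x) = lim v(x^n)/n ([logval]) is a homomorphism with v <= L <= v + 1.  It
satisfies the ultrametric inequality because L(z) >= 0 forces all powers of z
into V (-1), hence z into A°.  Then exp(-L) is a multiplicative norm that
induces the topology of A. *)

Set Implicit Arguments.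
Unset Strict Implicit.
Unset Printing Implicit Defensive.

Import Order.TTheory GRing.Theory Num.Theory.
Local Open Scope classical_set_scope.
Local Open Scope ring_scope.

(** * Filtrations by the powers of a unit *)

(** An exhaustive and separated multiplicative filtration V of a ring, indexed
by the integers, with a homomorphism w from the integers to the units such
that w a has level a (hence V a = w a * V 0).  The field [filt_closed] says
that V 0 is completely integrally closed: it contains every element whose
powers have bounded denominators. *)
Record closed_filtration (A : comPzRingType) (w : int -> A)
    (V : int -> set A) : Prop := {
  filt_le : forall a b x, b <= a -> V a x -> V b x;
  filtB : forall a x y, V a x -> V a y -> V a (x - y);
  filtM : forall a b x y, V a x -> V b y -> V (a + b) (x * y);
  filt_closed : forall b x, (forall n, V b (x ^+ n)) -> V 0 x;
  filt_w : forall a, V a (w a);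
  filt_w0 : w 0 = 1;
  filt_wD : forall a b, w (a + b) = w a * w b;
  filt_exhaustive : forall x, exists a, V a x;
  filt_separated : forall x, (forall a, V a x) -> x = 0
}.

Section Filtration.
Context (A : comPzRingType) (w : int -> A) (V : int -> set A).
Context (HV : closed_filtration w V).

Lemma filt1 : V 0 1.
Proof. by rewrite -(filt_w0 HV); apply: (filt_w HV). Qed.

Lemma filt0 a : V a 0.
Proof. by rewrite -(subrr (w a)); apply: (filtB HV) => //; apply: (filt_w HV). Qed.

Lemma filtN a x : V a x -> V a (- x).
Proof. by move=> Vx; rewrite -sub0r; apply: (filtB HV) => //; apply: filt0. Qed.

Lemma filtD a x y : V a x -> V a y -> V a (x + y).
Proof. by move=> Vx Vy; rewrite -(opprK y); apply: (filtB HV) => //; apply: filtN. Qed.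

Lemma filt_wN a : w a * w (- a) = 1.
Proof. by rewrite -(filt_wD HV) subrr (filt_w0 HV). Qed.

Lemma filt_shift a b x : V (a + b) (w a * x) <-> V b x.
Proof.
split=> [Vx|]; last by apply: (filtM HV) => //; apply: (filt_w HV).
have -> : x = w (- a) * (w a * x) by rewrite mulrA [w (- a) * _]mulrC filt_wN mul1r.
have -> : b = - a + (a + b) by lia.
by apply: (filtM HV) => //; apply: (filt_w HV).
Qed.

Lemma filtX a x n : V a x -> V (a * n%:Z) (x ^+ n).
Proof.
move=> Vx; elim: n => [|n IHn]; first by rewrite mulr0 expr0; apply: filt1.
rewrite exprS; have -> : a * n.+1%:Z = a + a * n%:Z by lia.
exact: (filtM HV).
Qed.

Lemma filt_w_exp a n : w a ^+ n = w (a * n%:Z).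
Proof.
elim: n => [|n IHn]; first by rewrite expr0 mulr0 (filt_w0 HV).
by rewrite exprS IHn -(filt_wD HV); congr w; lia.
Qed.

(** For y = w (- a) * x with y ^+ n in V 0, every y ^+ k is the product of a
power of y ^+ n and one of finitely many elements, so [filt_closed] applies. *)
Lemma filt_root n a x : (0 < n)%N -> V (a * n%:Z) (x ^+ n) -> V a x.
Proof.
move=> n_gt0 Vxn; pose y := w (- a) * x.
suff: V 0 y by rewrite -[0](addNr a) => /(filt_shift (- a)).
have Vyn : V 0 (y ^+ n).
  rewrite exprMn filt_w_exp.
  have -> : 0 = - a * n%:Z + a * n%:Z by lia.
  by apply: (filtM HV) => //; apply: (filt_w HV).
have [b Vb] : exists b, forall r, (r < n)%N -> V b (y ^+ r).
  elim: n {n_gt0 Vxn Vyn} => [|n [b Vb]]; first by exists 0.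
  have [c Vc] := filt_exhaustive HV (y ^+ n).
  exists (Num.min b c) => r; rewrite ltnS leq_eqVlt => /predU1P[->|ltrn].
    by apply: (filt_le HV) Vc; lia.
  by apply: (filt_le HV) (Vb _ ltrn); lia.
apply: (filt_closed HV (b := b)) => k.
rewrite (divn_eq k n) exprD mulnC exprM -[b]add0r; apply: (filtM HV) => //.
  by have := filtX (k %/ n) Vyn; rewrite mul0r.
by apply: Vb; rewrite ltn_mod.
Qed.

Lemma filt_level x : x <> 0 -> exists2 a, V a x & ~ V (a + 1) x.
Proof.
move=> x0; apply: contrapT => noa.
have step a : V a x -> V (a + 1) x.
  by move=> Va; apply: contrapT => Va1; apply: noa; exists a.
apply: x0; apply: (filt_separated HV) => b.
have [a Va] := filt_exhaustive HV x.
have Vn (n : nat) : V (a + n%:Z) x.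
  elim: n => [|n IHn]; first by rewrite addr0.
  have -> : a + n.+1%:Z = a + n%:Z + 1 by lia.
  exact: step.
by apply: (filt_le HV) (Vn `|b - a|%N); lia.
Qed.

End Filtration.

Lemma le_asymptotic (R : realType) (s t K : R) :
  (forall n, (0 < n)%N -> n%:R * s <= n%:R * t + K) -> s <= t.
Proof.
move=> st; rewrite leNgt; apply/negP => lt_ts.
have st0 : 0 < s - t by rewrite subr_gt0.
have /st := ltn0Sn (Num.truncn (K / (s - t))).
by rewrite -lerBlDl -mulrBr -ler_pdivlMr // leNgt Num.Theory.truncnS_gt.
Qed.

(** * Almost multiplicativity of a complete filtration on a field *)

Lemma inverse_neq0 (A : comPzRingType) (x y : A) : x * y = 1 -> x <> 0 -> y <> 0.
Proof.
move=> xy x0 y0; apply: x0.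
by rewrite -[x]mulr1 -xy y0 !mulr0.
Qed.

Section FieldFiltration.
Context (A : comPzRingType) (w : int -> A) (V : int -> set A).
Context (HV : closed_filtration w V).
Context (A_field : forall x : A, x <> 0 -> exists y, x * y = 1).
Context (V_complete : forall f : nat -> A,
  (forall n, V n%:Z (f n.+1 - f n)) ->
  exists l, forall a, exists N, forall n, (N <= n)%N -> V a (l - f n)).

(** The inductive step: a small change of f makes its inverse larger. *)
Lemma perturbation_step (t : int) (f g : A) :
  4%:Z <= t -> f * g = 1 -> ~ V 1 f -> ~ V (- (4%:Z * t)) g ->
  exists f' g', [/\ f' * g' = 1, V t (f' - f), ~ V 1 f' &
                    ~ V (- (4%:Z * (t + 1))) g'].
Proof.
move=> t4 fg Vf Vg.
suff [f' [g' [fg' Vd Vg']]] : exists f' g', [/\ f' * g' = 1, V t (f' - f) &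
                    ~ V (- (4%:Z * (t + 1))) g'].
  exists f', g'; split=> // Vf'; apply: Vf.
  rewrite -(subKr f' f); apply: (filtB HV) Vf' _ => //.
  by apply: (filt_le HV) Vd; lia.
pose c := w (3%:Z * t).
have Vc : V (3%:Z * t) c by apply: (filt_w HV).
have fc0 : f + c <> 0.
  move=> fc0; apply: Vf; rewrite -[f]opprK (addr0_eq fc0).
  by apply: (filtN HV); apply: (filt_le HV) Vc; lia.
have [h fch] := A_field fc0.
have [Vh|Vh] := pselect (V (- (4%:Z * (t + 1))) h); last first.
  exists (f + c), h; split=> //.
  by rewrite addrC addKr; apply: (filt_le HV) Vc; lia.
exists (f ^+ 2 * h), (g + c * g ^+ 2); split.
- have -> : f ^+ 2 * h * (g + c * g ^+ 2) =
    (f * g) * (h * (f + (f * g) * c)) by ring.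
  by rewrite fg !mul1r mulrC.
- have -> : f ^+ 2 * h - f = c ^+ 2 * h - c.
    have -> : f ^+ 2 * h - f = f * ((f + c) * h) - f - c * ((f + c) * h) + c ^+ 2 * h by ring.
    by rewrite fch; ring.
  apply: (filtB HV) => //; last by apply: (filt_le HV) Vc; lia.
  have := filtM HV (filtX HV 2 Vc) Vh.
  by apply: (filt_le HV); lia.
- move=> Vg'.
  have g0 : g <> 0 by move=> g0; apply: Vg; rewrite g0; apply: (filt0 HV).
  have [k Vk Vk1] := filt_level HV g0.
  have k_lt : k < - (4%:Z * t).
    by rewrite ltNge; apply/negP => ?; apply: Vg; apply: (filt_le HV) Vk.
  (* Both g' and g lie in V (3t + 2(k + 1)), hence so does their difference
     c * g ^+ 2; thus g ^+ 2 is in V (2(k + 1)), and g is in V (k + 1). *)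
  apply: Vk1; apply: (filt_root HV (n := 2)) => //.
  apply/(filt_shift HV (3%:Z * t)); rewrite -/c.
  have -> : c * g ^+ 2 = (g + c * g ^+ 2) - g by rewrite [g + _]addrC addrK.
  apply: (filtB HV).
    by apply: (filt_le HV) Vg'; lia.
  by apply: (filt_le HV) Vk; lia.
Qed.

(** Continuity of inversion at the unit l, in a weak form. *)
Lemma inverses_bounded (f g : nat -> A) (l h : A) :
  (forall n, f n * g n = 1) -> l * h = 1 ->
  (forall a, exists N, forall n, (N <= n)%N -> V a (l - f n)) ->
  exists b N, forall n, (N <= n)%N -> V b (g n).
Proof.
move=> fg lh cvf.
have [b Vb] := filt_exhaustive HV h.
have [N cvN] := cvf (1 - b).
exists b, N => n leNn.
have gE : g n = h + g n * (h * (l - f n)).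
  have -> : h + g n * (h * (l - f n)) = h + g n * (l * h) - (f n * g n) * h.
    by ring.
  by rewrite fg lh mulr1 mul1r addrC addKr.
(* In the formula for g n, the second summand has a higher level than g n, so
   the level of g n can be raised until it reaches the level b of h. *)
have step c : c < b -> V c (g n) -> V (c + 1) (g n).
  move=> ltcb Vc; rewrite gE; apply: (filtD HV).
    by apply: (filt_le HV) Vb; lia.
  apply: (filtM HV) Vc _; have -> : 1 = b + (1 - b) by lia.
  by apply: (filtM HV) Vb _; apply: cvN.
have [c Vc] := filt_exhaustive HV (g n).
have Vmin (k : nat) : V (Num.min b (c + k%:Z)) (g n).
  elim: k => [|k IHk]; first by apply: (filt_le HV) Vc; lia.
  have [ltkb|lebk] := ltP (c + k%:Z) b; last first.
    by apply: (filt_le HV) IHk; lia.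
  have /step : Num.min b (c + k%:Z) < b by lia.
  by move=> /(_ IHk); apply: (filt_le HV); lia.
by apply: (filt_le HV) (Vmin `|b - c|%N); lia.
Qed.

(** In terms of v(x) = max {a | V a x}: v(x) + v(1/x) >= -2.  The statement is
about the least levels a = v(x) + 1 and b = v(y) + 1 that are not attained. *)
Lemma quasi_inverse (a b : int) (x y : A) :
  x * y = 1 -> ~ V a x -> ~ V b y -> 0 <= a + b.
Proof.
move=> xy Va Vb; rewrite leNgt; apply/negP => ab.
pose inv (n : nat) (s : A * A) :=
  [/\ s.1 * s.2 = 1, ~ V 1 s.1 & ~ V (- (4%:Z * (n%:Z + 4%:Z))) s.2].
(* Since a + b <= -1, the 16th powers give the room that is needed to start
   with t = 4. *)
pose f0 := w (1 - a * 16%:Z) * x ^+ 16; pose g0 := w (a * 16%:Z - 1) * y ^+ 16.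
have inv0 : inv 0%N (f0, g0).
  split=> /=.
  - rewrite /f0 /g0 mulrACA -exprMn xy expr1n mulr1 -(opprB 1).
    exact: (filt_wN HV).
  - have {1}-> : 1 = (1 - a * 16%:Z) + a * 16%:Z by lia.
    by move=> /(filt_shift HV)/(filt_root HV)-/(_ isT).
  - move=> Vg; apply: Vb; apply: (filt_root HV (n := 16)) => //.
    apply/(filt_shift HV (a * 16%:Z - 1)); apply: (filt_le HV) Vg; lia.
have /choice [S HS] (ns : nat * (A * A)) : exists s', inv ns.1 ns.2 ->
    inv ns.1.+1 s' /\ V (ns.1%:Z + 4%:Z) (s'.1 - ns.2.1).
  have [invs|] := pselect (inv ns.1 ns.2); last by exists (0, 0).
  have [fg Vf Vg] := invs.
  have t4 : 4%:Z <= ns.1%:Z + 4%:Z by lia.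
  have [f' [g' [fg' Vd Vf' Vg']]] := perturbation_step t4 fg Vf Vg.
  exists (f', g') => _; split=> //; split=> //=.
  by have -> : ns.1.+1%:Z + 4%:Z = ns.1%:Z + 4%:Z + 1 by lia.
pose F := fix F n := if n is m.+1 then S (m, F m) else (f0, g0).
have invF n : inv n (F n).
  by elim: n => [//|n IHn]; case: (HS (n, F n) IHn).
have VF n : V (n%:Z + 4%:Z) ((F n.+1).1 - (F n).1).
  by case: (HS (n, F n) (invF n)).
have [|l cvF] := V_complete (f := fun n => (F n).1).
  by move=> n; apply: (filt_le HV) (VF n); lia.
have l0 : l <> 0.
  move=> l0; have [N /(_ N (leqnn N))] := cvF 1.
  rewrite l0 sub0r => /(filtN HV); rewrite opprK.
  by case: (invF N).
have [h lh] := A_field l0.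
have fgF n : (F n).1 * (F n).2 = 1 by case: (invF n).
have [c [N VN]] := inverses_bounded fgF lh cvF.
pose n := maxn N `|c|%N.
case: (invF n) => _ _; apply.
by apply: (filt_le HV) (VN n _); rewrite ?leq_maxl // /n; lia.
Qed.

(** * The valuation attached to the filtration *)

Lemma field_mul_neq0 (x y : A) : x <> 0 -> y <> 0 -> x * y <> 0.
Proof.
move=> x0 y0 xy0; have [z yz] := A_field y0.
by apply: x0; rewrite -[x]mulr1 -yz mulrA xy0 mul0r.
Qed.

Lemma field_expr_neq0 (x : A) n : x <> 0 -> x ^+ n <> 0.
Proof.
move=> x0; have [y xy] := A_field x0 => xn0; apply: x0.
have : (x * y) ^+ n = 1 by rewrite xy expr1n.
by rewrite exprMn xn0 mul0r => one0; rewrite -[x]mulr1 -one0 mulr0.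
Qed.

Context (R : realType).

(** The homogenization L(x) = lim v(x^n)/n, where v(x) is the largest a such
that x is in V a.  It is a supremum since the sequence n |-> v(x^n) is
superadditive.  The value at 0 is meaningless. *)
Definition logval (x : A) : R :=
  sup [set r | exists n a, [/\ (0 < n)%N, V a (x ^+ n) & r = a%:~R / n%:R]].

Lemma logval_bound (x : A) (m n : nat) (a b : int) : (0 < m)%N -> (0 < n)%N ->
  V a (x ^+ m) -> ~ V b (x ^+ n) -> a%:~R / m%:R <= b%:~R / n%:R :> R.
Proof.
move=> m0 n0 Va Vb.
rewrite ler_pdivrMr ?ltr0n // mulrAC ler_pdivlMr ?ltr0n //.
rewrite !pmulrn -!intrM ler_int leNgt; apply/negP => ltba.
apply: Vb; apply: (filt_root HV (n := m)) => //.
rewrite -exprM mulnC exprM; apply: (filt_le HV) (filtX HV n Va); lia.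
Qed.

Lemma logval_ge (x : A) n a : (0 < n)%N -> x <> 0 ->
  V a (x ^+ n) -> a%:~R <= n%:R * logval x.
Proof.
move=> n0 x0 Va; rewrite mulrC -ler_pdivrMr ?ltr0n //.
have [b _ Vb] := filt_level HV x0.
apply: ub_le_sup; last by exists n, a.
exists ((b + 1)%:~R / 1%:R) => _ [m [c [m0 Vc ->]]].
by apply: (logval_bound (x := x)) => //; rewrite expr1.
Qed.

Lemma logval_le (x : A) n a : (0 < n)%N ->
  ~ V a (x ^+ n) -> n%:R * logval x <= a%:~R.
Proof.
move=> n0 Va; rewrite mulrC -ler_pdivlMr ?ltr0n //.
apply: ge_sup.
  have [b Vb] := filt_exhaustive HV x.
  by exists (b%:~R / 1%:R), 1%N, b; rewrite expr1.
by move=> _ [m [c [m0 Vc ->]]]; apply: (logval_bound (x := x)).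
Qed.

Lemma logval_super (x y : A) : x <> 0 -> y <> 0 ->
  logval x + logval y <= logval (x * y).
Proof.
move=> x0 y0; apply: (@le_asymptotic _ _ _ 2) => n n0.
have [a Va Va1] := filt_level HV (field_expr_neq0 (n := n) x0).
have [b Vb Vb1] := filt_level HV (field_expr_neq0 (n := n) y0).
have Vab := filtM HV Va Vb; rewrite -exprMn in Vab.
have := logval_ge n0 (field_mul_neq0 x0 y0) Vab.
have := logval_le n0 Va1; have := logval_le n0 Vb1.
rewrite !intrD; lra.
Qed.

Lemma logval1 : (1 : A) <> 0 -> logval 1 = 0.
Proof.
move=> one0; apply/eqP; rewrite eq_le; apply/andP; split; last first.
  have := logval_ge (n := 1) isT one0 (filt1 HV : V 0 (1 ^+ 1)).
  by rewrite mul1r.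
have := logval_super one0 one0; rewrite mulr1; lra.
Qed.

Lemma logvalV (x y : A) : x <> 0 -> x * y = 1 -> logval x + logval y = 0.
Proof.
move=> x0 xy; have y0 := inverse_neq0 xy x0.
have one0 : (1 : A) <> 0 by rewrite -xy; apply: field_mul_neq0.
apply/eqP; rewrite eq_le -{1}(logval1 one0) -{1}xy logval_super //=.
apply: (@le_asymptotic _ _ _ 2) => n n0.
have [a Va Va1] := filt_level HV (field_expr_neq0 (n := n) x0).
have xyn : x ^+ n * y ^+ n = 1 by rewrite -exprMn xy expr1n.
have Vb : V (- a - 2) (y ^+ n).
  by apply: contrapT => Vb; have := quasi_inverse xyn Va1 Vb; lia.
have := logval_ge n0 x0 Va; have := logval_ge n0 y0 Vb.
rewrite intrB intrN; lra.
Qed.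

Lemma logvalM (x y : A) : x <> 0 -> y <> 0 ->
  logval (x * y) = logval x + logval y.
Proof.
move=> x0 y0; have [z yz] := A_field y0; have z0 := inverse_neq0 yz y0.
apply/eqP; rewrite eq_le logval_super // andbT.
have := logval_super (field_mul_neq0 x0 y0) z0.
by rewrite -mulrA yz mulr1; have := logvalV y0 yz; lra.
Qed.

(** If some power x ^+ n were not in V (-1), then n L(x) <= -1 would follow. *)
Lemma logval_ge0 (x : A) : x <> 0 -> 0 <= logval x -> V 0 x.
Proof.
move=> x0 vx; apply: (filt_closed HV (b := -1)) => n.
apply: contrapT; case: n => [|n Vn].
  by apply; apply: (filt_le HV) (filt1 HV).
have := logval_le (ltn0Sn n) Vn.
have : 0 <= n.+1%:R * logval x by rewrite mulr_ge0.
by rewrite intrN; lra.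
Qed.

Lemma logvalN (x : A) : x <> 0 -> logval (- x) = logval x.
Proof.
move=> x0; have N1 : (-1 : A) <> 0.
  by move=> N10; apply: x0; rewrite -[x]mulr1 -[1]opprK N10 oppr0 mulr0.
have vN1 : logval (-1) = 0.
  have := logvalM N1 N1; rewrite mulrNN mulr1 logval1; last first.
    by move=> one0; apply: N1; rewrite one0 oppr0.
  lra.
by rewrite -mulN1r logvalM // vN1 add0r.
Qed.

(** The hypothesis on y is guarded because L(0) carries no information. *)
Lemma logval_ultra (x y : A) : x <> 0 -> x + y <> 0 ->
  (y <> 0 -> logval x <= logval y) -> logval x <= logval (x + y).
Proof.
move=> x0 xy0 vxy; have [z xz] := A_field x0; have z0 := inverse_neq0 xz x0.
have xyE : x + y = x * (1 + y * z).
  have -> : x * (1 + y * z) = x + y * (x * z) by ring.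
  by rewrite xz mulr1.
have u0 : 1 + y * z <> 0 by move=> u0; apply: xy0; rewrite xyE u0 mulr0.
rewrite xyE logvalM // lerDl.
have Vyz : V 0 (y * z).
  have [->|/eqP y0] := eqVneq y 0; first by rewrite mul0r; apply: (filt0 HV).
  apply: logval_ge0; first exact: field_mul_neq0.
  by rewrite logvalM //; have := vxy y0; have := logvalV x0 xz; lra.
have Vu : V 0 ((1 + y * z) ^+ 1) by apply: (filtD HV) => //; apply: (filt1 HV).
by have := logval_ge (n := 1) isT u0 Vu; rewrite mul1r.
Qed.

End FieldFiltration.

(** * Submultiplicative norms *)

Section SubmultiplicativeNorm.
Context (R : realType) (A : comPzRingType) (nu : A -> R).
Context (Hnu : submultiplicative_norm nu).

Lemma norm0 : nu 0 = 0.
Proof. by apply/(norm_eq0 Hnu). Qed.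

Lemma norm_opp_le x : nu (- x) <= nu x.
Proof.
rewrite -sub0r; apply: le_trans (norm_ultra Hnu 0 x) _.
by rewrite norm0 ge_max lexx (norm_nonneg Hnu).
Qed.

Lemma norm_opp x : nu (- x) = nu x.
Proof. by apply/eqP; rewrite eq_le norm_opp_le -{1}[x]opprK norm_opp_le. Qed.

Lemma norm_add_le x y M : nu x <= M -> nu y <= M -> nu (x + y) <= M.
Proof.
move=> xM yM; rewrite -[y]opprK; apply: le_trans (norm_ultra Hnu _ _) _.
by rewrite ge_max norm_opp xM.
Qed.

Lemma norm_mulrn_le x n : nu (x *+ n) <= nu x.
Proof.
elim: n => [|n IHn]; first by rewrite mulr0n norm0 (norm_nonneg Hnu).
by rewrite mulrS norm_add_le.
Qed.

Lemma norm_mul_le x y M N : nu x <= M -> nu y <= N -> nu (x * y) <= M * N.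
Proof.
move=> xM yN; apply: le_trans (norm_submul Hnu _ _) _.
by apply: ler_pM => //; apply: (norm_nonneg Hnu).
Qed.

(** Power-boundedness measured by the norm. *)
Definition norm_power_bounded (x : A) := exists M, forall n, nu (x ^+ n) <= M.

Lemma norm_power_bounded_eventually x N :
  (forall n, (N <= n)%N -> nu (x ^+ n) <= 1) -> norm_power_bounded x.
Proof.
elim: N => [|N IHN] xN; first by exists 1 => n; apply: xN.
have [M xM] : exists M, forall n, (n <= N)%N -> nu (x ^+ n) <= M.
  elim: N {IHN xN} => [|N [M xM]].
    by exists (nu 1) => n; rewrite leqn0 => /eqP ->; rewrite expr0.
  exists (Num.max M (nu (x ^+ N.+1))) => n; rewrite leq_eqVlt.
  by move=> /predU1P[->|/xM xn]; rewrite le_max ?lexx ?orbT // xn.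
exists (Num.max M 1) => n; rewrite le_max.
by have [/xM ->//|/xN ->] := leqP n N; rewrite orbT.
Qed.

Lemma norm_power_bounded_le1 x : nu x <= 1 -> norm_power_bounded x.
Proof.
move=> x1; apply: (@norm_power_bounded_eventually _ 1) => -[//|n] _.
elim: n => [//|n IHn]; rewrite exprS -[1]mulr1.
exact: norm_mul_le.
Qed.

Lemma norm_power_boundedM x y :
  norm_power_bounded x -> norm_power_bounded y -> norm_power_bounded (x * y).
Proof.
move=> [M xM] [N yN]; exists (M * N) => n.
by rewrite exprMn norm_mul_le.
Qed.

Lemma norm_power_boundedD x y :
  norm_power_bounded x -> norm_power_bounded y -> norm_power_bounded (x + y).
Proof.
move=> [M xM] [N yN]; exists (M * N) => n.
have MN0 : 0 <= M * N.
  by apply: mulr_ge0;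
    [apply: le_trans (xM 0%N)|apply: le_trans (yN 0%N)]; apply: (norm_nonneg Hnu).
rewrite exprDn; elim/big_ind: _ => [||i _].
- by rewrite norm0.
- by move=> *; apply: norm_add_le.
- by apply: le_trans (norm_mulrn_le _ _) _; apply: norm_mul_le.
Qed.

Lemma norm_power_bounded1 : norm_power_bounded 1.
Proof. by exists (nu 1) => n; rewrite expr1n. Qed.

Lemma norm_power_boundedN x : norm_power_bounded x -> norm_power_bounded (- x).
Proof.
move=> xb; rewrite -mulN1r; apply: norm_power_boundedM xb.
exists (nu 1) => n; rewrite -signr_odd; case: odd => //=.
by rewrite expr1 norm_opp.
Qed.

End SubmultiplicativeNorm.

(** * The filtration of a uniform Banach ring *)

(** The powers of a unit w with integral exponents, where u is the inverse of
w: w ^ a for a >= 0 and u ^ (- a) for a < 0. *)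
Definition int_power (A : comPzRingType) (w u : A) (a : int) : A :=
  match a with Posz n => w ^+ n | Negz n => u ^+ n.+1 end.

Lemma int_powerB (A : comPzRingType) (w u : A) (m n : nat) : w * u = 1 ->
  int_power w u (m%:Z - n%:Z) = w ^+ m * u ^+ n.
Proof.
move=> wu; elim: n m => [|n IHn] [|m].
- by rewrite subr0 expr0 mulr1.
- by rewrite subr0 mulr1.
- by rewrite sub0r -NegzE /= expr0 mul1r.
have -> : m.+1%:Z - n.+1%:Z = m%:Z - n%:Z by lia.
by rewrite IHn !exprSr mulrACA wu mulr1.
Qed.

Lemma int_powerD (A : comPzRingType) (w u : A) (a b : int) : w * u = 1 ->
  int_power w u (a + b) = int_power w u a * int_power w u b.
Proof.
move=> wu.
have intE (c : int) : exists m n : nat, c = m%:Z - n%:Z.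
  case: c => n; first by exists n, 0%N; rewrite subr0.
  by exists 0%N, n.+1; rewrite NegzE sub0r.
have [[m1 [n1 ->]] [m2 [n2 ->]]] := (intE a, intE b).
have -> : m1%:Z - n1%:Z + (m2%:Z - n2%:Z) = (m1 + m2)%:Z - (n1 + n2)%:Z by lia.
by rewrite !int_powerB // !exprD mulrACA.
Qed.

Section UniformBanachRing.
Context (R : realType) (A : topologicalComRingType) (nu : A -> R).
Context (Hnu : submultiplicative_norm nu) (Htop : induces_topology nu).
Context (w u : A) (wu : w * u = 1) (w_nil : topologically_nilpotent w).
Context (A_unif : uniform_ring A).

Lemma nbhs_normP (x : A) (U : set A) :
  nbhs x U <-> exists2 e, 0 < e & forall y, nu (x - y) < e -> U y.
Proof. by rewrite (Htop x); split=> -[e e0 eU]; exists e. Qed.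

Lemma nilpotent_norm e : 0 < e ->
  exists N, forall n, (N <= n)%N -> nu (w ^+ n) < e.
Proof.
move=> e0.
have /w_nil [N _ NU] : nbhs (0 : A) [set y | nu y < e].
  by apply/nbhs_normP; exists e => // y; rewrite sub0r (norm_opp Hnu).
by exists N => n; apply: NU.
Qed.

(** The direct implication uses the topologically nilpotent unit w: if w ^+ N
maps S into the unit ball, then S lies in the ball of radius nu (u ^+ N). *)
Lemma bounded_subset_normP (S : set A) :
  bounded_subset S <-> exists M, forall s, S s -> nu s <= M.
Proof.
split=> [bS|[M SM] U /nbhs_normP[e e0 eU]].
  have [V /nbhs_normP[d d0 dV] VS] : exists2 V : set A, nbhs 0 V &
      forall v s, V v -> S s -> nu (v * s) < 1.
    apply: (bS [set y | nu y < 1]).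
    by apply/nbhs_normP; exists 1 => // y; rewrite sub0r (norm_opp Hnu).
  have [N /(_ N (leqnn N)) wN] := nilpotent_norm d0.
  exists (nu (u ^+ N)) => s Ss.
  have -> : s = u ^+ N * (w ^+ N * s).
    by rewrite mulrA [u ^+ N * _]mulrC -exprMn wu expr1n mul1r.
  rewrite -[leRHS]mulr1; apply: (norm_mul_le Hnu) => //.
  by apply/ltW/VS => //; apply: dV; rewrite sub0r (norm_opp Hnu).
have M1 : 0 < `|M| + 1 by rewrite ltr_wpDl.
exists [set v | nu v < e / (`|M| + 1)].
  apply/nbhs_normP; exists (e / (`|M| + 1)); first by rewrite divr_gt0.
  by move=> y; rewrite sub0r (norm_opp Hnu).
move=> v s /= ve /SM sM; apply: eU; rewrite sub0r (norm_opp Hnu).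
apply: (@le_lt_trans _ _ (nu v * (`|M| + 1))).
  apply: (norm_mul_le Hnu) => //.
  by apply: le_trans sM (le_trans (ler_norm _) _); rewrite lerDl.
by rewrite -ltr_pdivlMr.
Qed.

Lemma power_bounded_normP (x : A) : power_bounded A x <-> norm_power_bounded nu x.
Proof.
split=> [/bounded_subset_normP[M xM]|[M xM]].
  by exists M => n; apply: xM; exists n.
by apply/bounded_subset_normP; exists M => _ [n _ <-].
Qed.

(** The filtration by the fractional ideals w ^ a A°, where A° is the ring of
power-bounded elements. *)
Definition power_filtration (a : int) : set A :=
  [set x | power_bounded A (int_power w u (- a) * x)].

Let W := int_power w u.

Lemma int_powerNr a : W a * W (- a) = 1.
Proof. by rewrite -int_powerD // subrr. Qed.

Lemma power_filtration_norm : exists2 B, 0 < B &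
  forall a x, power_filtration a x -> nu x <= nu (W a) * B.
Proof.
have /bounded_subset_normP[M AM] := A_unif.
exists (`|M| + 1); first by rewrite ltr_wpDl.
move=> a x /AM xM.
rewrite -[x]mul1r -(int_powerNr a) -mulrA; apply: (norm_mul_le Hnu) => //.
by apply: le_trans xM (le_trans (ler_norm _) _); rewrite lerDl.
Qed.

Lemma norm_power_filtration a :
  exists2 d, 0 < d & forall x, nu x < d -> power_filtration a x.
Proof.
have W1 : 0 < nu (W (- a)) + 1 by rewrite ltr_wpDl // (norm_nonneg Hnu).
exists (nu (W (- a)) + 1)^-1; first by rewrite invr_gt0.
move=> x xd; apply/power_bounded_normP/(norm_power_bounded_le1 Hnu).
apply: (@le_trans _ _ ((nu (W (- a)) + 1) * (nu (W (- a)) + 1)^-1)).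
  by apply: (norm_mul_le Hnu); [rewrite lerDl|apply: ltW].
by rewrite divff // gt_eqF.
Qed.

Lemma power_filtration_small e : 0 < e ->
  exists a, forall x, power_filtration a x -> nu x < e.
Proof.
move=> e0; have [B B0 VB] := power_filtration_norm.
have [N /(_ N (leqnn N)) wN] := nilpotent_norm (divr_gt0 e0 B0).
exists N%:Z => x /VB xB; apply: le_lt_trans xB _.
by rewrite -ltr_pdivlMr.
Qed.

Lemma power_filtration_nbhs (x : A) (U : set A) :
  nbhs x U <-> exists a, forall y, power_filtration a (x - y) -> U y.
Proof.
split=> [/nbhs_normP[e e0 eU]|[a aU]].
  have [a aV] := power_filtration_small e0.
  by exists a => y /aV/eU.
have [d d0 dV] := norm_power_filtration a.
by apply/nbhs_normP; exists d => // y /dV/aU.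
Qed.

Lemma power_filtration_closed : closed_filtration W power_filtration.
Proof.
have pb := power_bounded_normP.
have wb : norm_power_bounded nu w.
  have [N wN] := nilpotent_norm ltr01.
  by apply: (norm_power_bounded_eventually (N := N)) => n /wN/ltW.
have wnb n : norm_power_bounded nu (w ^+ n).
  elim: n => [|n IHn]; first exact: norm_power_bounded1.
  by rewrite exprS; apply: (norm_power_boundedM Hnu).
split=> //.
- move=> a b x leba /pb ax; apply/pb.
  have -> : - b = `|a - b|%N%:Z + (- a) by lia.
  rewrite int_powerD // -mulrA; exact: (norm_power_boundedM Hnu (wnb _) ax).
- move=> a x y /pb ax /pb ay; apply/pb; rewrite mulrBr.
  by apply: (norm_power_boundedD Hnu) => //; apply: (norm_power_boundedN Hnu).
- move=> a b x y /pb ax /pb ay; apply/pb; rewrite opprD int_powerD // mulrACA.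
  exact: (norm_power_boundedM Hnu).
- move=> b x Vx; apply/pb; rewrite oppr0 mul1r.
  have [B _ VB] := power_filtration_norm.
  by exists (nu (W b) * B) => n; apply: VB.
- move=> a; apply/pb; rewrite mulrC int_powerNr; exact: norm_power_bounded1.
- by move=> a b; apply: int_powerD.
- move=> x; have x1 : 0 < nu x + 1 by rewrite ltr_wpDl // (norm_nonneg Hnu).
  have [N /(_ N (leqnn N)) wN] := nilpotent_norm (divr_gt0 ltr01 x1).
  exists (- N%:Z); apply/pb; rewrite opprK; apply: (norm_power_bounded_le1 Hnu).
  rewrite -(@divff _ (nu x + 1)) ?gt_eqF // mulrC -div1r.
  by apply: (norm_mul_le Hnu); [rewrite lerDl|apply: ltW].
- move=> x Vx; apply/(norm_eq0 Hnu); apply/eqP; rewrite eq_le (norm_nonneg Hnu).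
  rewrite andbT leNgt; apply/negP => /power_filtration_small[a /(_ x (Vx a))].
  by rewrite ltxx.
Qed.

Lemma power_filtration_complete : complete_ring A -> forall f : nat -> A,
  (forall n, power_filtration n%:Z (f n.+1 - f n)) ->
  exists l, forall a, exists N, forall n, (N <= n)%N ->
    power_filtration a (l - f n).
Proof.
move=> Acomp f Vf; have HV := power_filtration_closed.
have Vfmn m n : (n <= m)%N -> power_filtration n%:Z (f m - f n).
  move=> lenm; rewrite -(subnKC lenm); elim: (m - n)%N => [|k IHk].
    by rewrite addn0 subrr; apply: (filt0 HV).
  rewrite addnS -(subrKA (f (n + k)%N)); apply: (filtD HV) => //.
  by apply: (filt_le HV) (Vf (n + k)%N); lia.
have [|l fl] := Acomp (f @ \oo).
  move=> U /power_filtration_nbhs[a aU].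
  exists [set f k | k in [set k | (`|a| <= k)%N]].
    by exists `|a|%N => // k ak; exists k.
  move=> _ _ [m am <-] [n an <-]; apply: aU; rewrite sub0r opprB.
  have -> : f n - f m = (f n - f `|a|%N) - (f m - f `|a|%N).
    by rewrite opprB addrA subrK.
  by apply: (filt_le HV) (filtB HV (Vfmn _ _ an) (Vfmn _ _ am)); lia.
exists l => a.
have /fl[N _ NV] : nbhs l [set y | power_filtration a (l - y)].
  by apply/power_filtration_nbhs; exists a.
by exists N => n; apply: NV.
Qed.

End UniformBanachRing.

(** * The multiplicative norm *)

Section ValuationNorm.
Context (R : realType) (A : topologicalComRingType).
Context (w : int -> A) (V : int -> set A) (HV : closed_filtration w V).
Context (A_field : forall x : A, x <> 0 -> exists y, x * y = 1).
Context (A_one : (1 : A) <> 0).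
Context (V_complete : forall f : nat -> A,
  (forall n, V n%:Z (f n.+1 - f n)) ->
  exists l, forall a, exists N, forall n, (N <= n)%N -> V a (l - f n)).
Context (V_nbhs : forall (x : A) (U : set A),
  nbhs x U <-> exists a, forall y, V a (x - y) -> U y).

(** The norm exp (- L(x)), extended by 0 at x = 0. *)
Definition valuation_norm (x : A) : R :=
  if x == 0 then 0 else expR (- logval V R x).

Lemma valuation_norm0 : valuation_norm 0 = 0.
Proof. by rewrite /valuation_norm eqxx. Qed.

Lemma valuation_normE x : x <> 0 -> valuation_norm x = expR (- logval V R x).
Proof. by move=> /eqP/negPf x0; rewrite /valuation_norm x0. Qed.

Lemma valuation_norm_ge0 x : 0 <= valuation_norm x.
Proof. by rewrite /valuation_norm; case: ifP => // _; apply: expR_ge0. Qed.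

Lemma valuation_norm_eq0 x : valuation_norm x = 0 <-> x = 0.
Proof.
split=> [|->]; last exact: valuation_norm0.
have [//|/eqP x0] := eqVneq x 0.
by rewrite valuation_normE // => /eqP; rewrite gt_eqF // expR_gt0.
Qed.

Lemma valuation_normM x y :
  valuation_norm (x * y) = valuation_norm x * valuation_norm y.
Proof.
have [->|/eqP x0] := eqVneq x 0; first by rewrite mul0r valuation_norm0 mul0r.
have [->|/eqP y0] := eqVneq y 0; first by rewrite mulr0 valuation_norm0 mulr0.
rewrite !valuation_normE //; last exact: field_mul_neq0.
by rewrite (logvalM HV) // opprD expRD.
Qed.

Lemma valuation_normN x : valuation_norm (- x) = valuation_norm x.
Proof.
have [->|/eqP x0] := eqVneq x 0; first by rewrite oppr0.
have Nx0 : - x <> 0 by move=> /eqP; rewrite oppr_eq0 => /eqP.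
by rewrite !valuation_normE // (logvalN HV).
Qed.

Lemma valuation_norm_le_add x y : valuation_norm y <= valuation_norm x ->
  valuation_norm (x + y) <= valuation_norm x.
Proof.
move=> yx.
have [->|/eqP xy0] := eqVneq (x + y) 0.
  by rewrite valuation_norm0 valuation_norm_ge0.
have x0 : x <> 0.
  move=> x0; apply: xy0; rewrite x0 add0r; apply/valuation_norm_eq0/eqP.
  by move: yx; rewrite x0 valuation_norm0 eq_le valuation_norm_ge0 andbT.
rewrite !valuation_normE // ler_expR lerN2.
apply: (logval_ultra HV) => // y0.
by move: yx; rewrite !valuation_normE // ler_expR lerN2.
Qed.

Lemma valuation_norm_multiplicative : multiplicative_norm valuation_norm.
Proof.
split; last by move/valuation_norm_eq0.
  split.
  - exact: valuation_norm_ge0.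
  - exact: valuation_norm_eq0.
  - move=> x y; rewrite le_max.
    have [yx|/ltW xy] := leP (valuation_norm y) (valuation_norm x).
      by rewrite valuation_norm_le_add ?valuation_normN.
    have := @valuation_norm_le_add (- y) x.
    by rewrite valuation_normN addrC => -> //; rewrite orbT.
  - by move=> x y; rewrite valuation_normM.
exact: valuation_normM.
Qed.

Lemma valuation_norm_filtration (a : int) x :
  valuation_norm x < expR (- a%:~R) -> V a x.
Proof.
have [->|/eqP x0] := eqVneq x 0; first by move=> _; apply: (filt0 HV).
rewrite valuation_normE // ltr_expR ltrN2 => vx; apply: contrapT => Vx.
have : ~ V a (x ^+ 1) by [].
by move=> /(logval_le HV R (ltn0Sn 0)); rewrite mul1r leNgt vx.
Qed.

Lemma filtration_valuation_norm (a : int) x :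
  V a x -> valuation_norm x <= expR (- a%:~R).
Proof.
have [-> _|/eqP x0 Vx] := eqVneq x 0; first by rewrite valuation_norm0 expR_ge0.
rewrite valuation_normE // ler_expR lerN2 -[leRHS]mul1r.
exact: (logval_ge HV R (n := 1)).
Qed.

Lemma valuation_norm_topology : induces_topology valuation_norm.
Proof.
move=> x; apply/predeqP => U; split=> [/V_nbhs[a aU]|[e /= e0 eU]].
  exists (expR (- a%:~R)); first exact: expR_gt0.
  by move=> y /valuation_norm_filtration/aU.
apply/V_nbhs; exists (Num.truncn (- ln e)).+1%:Z => y /filtration_valuation_norm yx.
apply: eU; apply: le_lt_trans yx _.
rewrite -[ltRHS]lnK // ltr_expR -[ltRHS]opprK ltrN2.
exact: Num.Theory.truncnS_gt.
Qed.

End ValuationNorm.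

Lemma uniform_banach_field_nonarchimedean (R : realType)
    (A : topologicalComRingType) (w : A) :
  banach_field R A -> uniform_ring A -> ring_unit w ->
  topologically_nilpotent w -> nonarchimedean_field R A.
Proof.
move=> bA A_unif [u wu] w_nil; split=> //.
  (* In the discrete topology w would be nilpotent, which no unit is. *)
  move=> disc.
  have /w_nil [N _ /(_ N (leqnn N)) wN0] : nbhs (0 : A) [set 0].
    exact: open_nbhs_nbhs.
  case: bA => _ [+ _]; apply.
  rewrite -(expr1n A N) -wu exprMn.
  by have /= -> := wN0; rewrite mul0r.
case: bA => -[A_comp [nu [Hnu Htop]]] [A_one A_field].
have HV := power_filtration_closed Hnu Htop wu w_nil A_unif.
have V_comp := power_filtration_complete Hnu Htop wu w_nil A_unif A_comp.
have V_nbhs := power_filtration_nbhs Hnu Htop wu w_nil A_unif.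
exists (valuation_norm R (power_filtration w u)); split.
  exact: (valuation_norm_multiplicative R HV A_field A_one V_comp).
exact: (valuation_norm_topology R HV V_nbhs).
Qed.

Theorem theorem4p2 (R : realType) (p : nat) (A : topologicalComRingType) :
  prime p -> perfectoid_ring R p A -> banach_field R A ->
  perfectoid_field R p A.
Proof.
move=> _ perfA fieldA; split=> //.
have [_ A_unif [w [w_unit w_nil _ _]]] := perfA.
exact: uniform_banach_field_nonarchimedean w_unit w_nil.
Qed.
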